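(* Let $s,r,t$ be positive integers and let $T=\sum_{k=0}^{s}\binom{r}{k}$. Let $\mathcal{F}=(V,E)$ be an $r$-uniform hypergraph. Then there exist $E^*\subset E$ with $|E^*|\ge(tr2^{2r+1})^{-T-1}|E|$ and a map $c:V\to[r]$ such that: (i) $c(F)=[r]$ for all $F\in E^*$; (ii) there is a hypergraph $\mathcal{H}$ on vertex set $[r]$, all of whose edges have size at most $s$, such that for every $e\subseteq[r]$ with $|e|\le s$: if $e\in E(\mathcal{H})$, then for every $F\in E^*$ there are distinct $F_1,\dots,F_t\in E^*$ with $c(F\cap F_i)\supseteq e$ for each $i\in[t]$; and if $e\notin E(\mathcal{H})$, then for all distinct $F,F'\in E^*$ we have $c(F\cap F')\not\supseteq e$.
   Context: A hypergraph $\mathcal{F}=(V,E)$ has edge set $E$ consisting of subsets of $V$; it is $r$-uniform if every edge has exactly $r$ elements. $[r]=\{1,\dots,r\}$, and for $S\subseteq V$, $c(S)=\{c(v):v\in S\}$. *)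

(* Defs.v *)
From mathcomp Require Import all_boot all_order all_algebra.

Set Implicit Arguments.
Unset Strict Implicit.
Unset Printing Implicit Defensive.

(* A finite hypergraph on the vertex set V is given by its edge set, of type
   {set {set V}}; the set [r] = {1, ..., r} is represented by 'I_r. *)

Definition uniform (V : finType) (r : nat) (E : {set {set V}}) : Prop :=
  forall F : {set V}, F \in E -> #|F| = r.

(* Main.v *)
(* A colouring of V chosen by averaging is rainbow on a proportion at least
   r!/r^r >= 4^-r of the edges.  On rainbow edges of size r, c(F :&: F') contains e
   iff F and F' have the same e-coloured vertices, so each e defines a partition of
   the edges.  Start with all e of size at most s unsettled and repeatedly delete
   edges lying in a class of size < t for some unsettled e.  Either half of the
   edges survive, and the unsettled e form H; or some e is responsible for a
   proportion 1/(2 * #unsettled) of the edges, at most t in each of its classes, and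
   a transversal of those settles e for good, at a cost of 2 * #unsettled * t. *)
Require Import Defs.
From mathcomp Require Import all_boot all_order all_algebra.

(** * Binomial and factorial estimates *)

Lemma leq_bin_exp2 n k : 'C(n, k) <= 2 ^ n.
Proof.
rewrite -{1 2}[n]card_ord -card_draws -cardsT -card_powerset powersetT.
by rewrite cardsT max_card.
Qed.

Lemma leq_exp_fact r : r ^ r <= 4 ^ r * r`!.
Proof.
have le1 : r ^ r <= (2 * r) ^_ r.
  rewrite ffact_prod -{2}[r]card_ord -prod_nat_const.
  by apply: leq_prod => i _; rewrite mulSn mul1n -addnBA ?leq_addr // ltnW.
rewrite (leq_trans le1) // -bin_ffact leq_mul2r -[4]/(2 ^ 2) -expnM.
by rewrite leq_bin_exp2 orbT.
Qed.

Lemma card_small_sets r s :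
  #|[set e : {set 'I_r} | #|e| <= s]| <= \sum_(0 <= k < s.+1) 'C(r, k).
Proof.
have cardk k : #|[set e : {set 'I_r} | #|e| == k]| = 'C(r, k).
  by rewrite card_draws card_ord.
elim: s => [|s IHs]; rewrite big_nat_recr //=.
  rewrite big_geq // add0n -cardk.
  by apply/subset_leq_card/subsetP => e; rewrite !inE leqn0.
rewrite -cardk.
apply: leq_trans (leq_add IHs (leqnn _)).
apply: leq_trans (leq_card_setU _ _).
by apply/subset_leq_card/subsetP => e; rewrite !inE leq_eqVlt ltnS orbC.
Qed.

(** * Averaging over all colourings *)

Section RainbowColourings.

Context {V : finType} {r : nat}.
Implicit Types (F : {set V}) (c : {ffun V -> 'I_r}).

Definition colour_restr F c : {ffun {x | x \in F} -> 'I_r} :=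
  [ffun x => c (val x)].

Lemma card_colour_restr_fibre F (g : {ffun {x | x \in F} -> 'I_r}) :
  #|[set c | colour_restr F c == g]| = r ^ #|~: F|.
Proof.
(* [P x] is the set of colours allowed at [x]: one colour on [F], all [r] off [F]. The fibre is the
   product of these sets. *)
pose P x : pred 'I_r := fun j => if insub x is Some y then j == g y else true.
have -> : #|[set c | colour_restr F c == g]| = #|family P|.
  apply: eq_card => c; rewrite !inE; apply/eqP/familyP => [cg x | cP].
    by rewrite /P unfold_in; case: insubP => // y _ <-; rewrite -cg ffunE.
  apply/ffunP=> y; rewrite ffunE.
  by have := cP (val y); rewrite /P unfold_in valK => /eqP.
rewrite card_family foldrE big_image /= (bigID (mem F)) /= big1 => [|x xF].
  rewrite mul1n -prod_nat_const; apply: eq_big => [x|x xF]; first by rewrite inE.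
  rewrite -[RHS]card_ord; apply: eq_card => j.
  by rewrite /P unfold_in insubN.
rewrite -(card1 (g (Sub x xF))); apply: eq_card => j.
by rewrite /P unfold_in insubT.
Qed.

(** There are as many vertices in [F] as colours, so onto and one-to-one agree. *)
Lemma rainbowE F c : #|F| = r ->
  (c @: F == [set: 'I_r]) = injectiveb (colour_restr F c).
Proof.
move=> cardF; rewrite eqEcard subsetT cardsT card_ord /=.
apply/idP/injectiveP => [leF x y | inj_c].
  rewrite !ffunE => cxy; apply: val_inj.
  suff /imset_injP : #|c @: F| == #|F| by apply=> //; apply: valP.
  by rewrite eqn_leq leq_imset_card cardF.
rewrite card_in_imset ?cardF // => x y xF yF cxy.
have /inj_c/(congr1 val) // : colour_restr F c (Sub x xF) = colour_restr F c (Sub y yF).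
by rewrite !ffunE.
Qed.

Lemma card_rainbow F : #|F| = r ->
  r ^ r * #|[set c : {ffun V -> 'I_r} | c @: F == [set: 'I_r]]| = r`! * #|{ffun V -> 'I_r}|.
Proof.
move=> cardF.
have cardFs : #|{: {x | x \in F}}| = r by rewrite card_sig.
have -> : #|[set c : {ffun V -> 'I_r} | c @: F == [set: 'I_r]]| = r`! * r ^ #|~: F|.
  have -> : r`! = #|[set g : {ffun {x | x \in F} -> 'I_r} | injectiveb g]|.
    by rewrite card_inj_ffuns card_ord cardFs ffactnn.
  rewrite -sum1_card (partition_big (colour_restr F)
    (mem [set g : {ffun {x | x \in F} -> 'I_r} | injectiveb g])) => [|c] /=.
    rewrite -sum_nat_const; apply: eq_bigr => g; rewrite inE => inj_g.
    rewrite -(card_colour_restr_fibre _ g) -sum1_card; apply: eq_bigl => c.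
    by rewrite !inE rainbowE //; case: eqP => [->|]; rewrite ?inj_g ?andbF.
  by rewrite !inE rainbowE.
by rewrite card_ffun card_ord mulnCA -expnD -(cardsC F) cardF.
Qed.

Lemma exists_rainbow (E : {set {set V}}) : 0 < r -> uniform r E ->
  exists c, #|E| <= 4 ^ r * #|[set F in E | c @: F == [set: 'I_r]]|.
Proof.
move=> r_gt0 unifE; pose N c := #|[set F in E | c @: F == [set: 'I_r]]|.
pose c0 : {ffun V -> 'I_r} := [ffun=> Ordinal r_gt0].
have [c _ maxc] : {c | true & forall c', N c' <= N c}.
  by case: (@arg_maxnP _ c0 predT N isT) => c _ maxc; exists c => // c'; apply: maxc.
exists c; rewrite -/(N c).
(* Double counting of the pairs of a colouring and an edge rainbow under it; the maximal [N c] is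
   then at least the average. *)
have sumN : r ^ r * \sum_c' N c' = #|E| * (r`! * #|{ffun V -> 'I_r}|).
  rewrite -sum_nat_const; under eq_bigr => c' _.
    rewrite /N -sum1dep_card big_mkcondr /=; over.
  rewrite exchange_big big_distrr /=; apply: eq_bigr => F FE.
  by rewrite -(card_rainbow F (unifE F FE)) -sum1dep_card [in RHS]big_mkcond.
have cols_gt0 : 0 < #|{ffun V -> 'I_r}| by apply/card_gt0P; exists c0.
have : #|E| * r`! <= r ^ r * N c.
  rewrite -(leq_pmul2r cols_gt0) -mulnA -sumN -mulnA leq_mul2l mulnC.
  by rewrite -sum_nat_const leq_sum ?orbT.
move=> leE; rewrite -(leq_pmul2r (fact_gt0 r)) (leq_trans leE) //.
by rewrite mulnAC leq_mul2r leq_exp_fact orbT.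
Qed.

End RainbowColourings.

(** * Passing to a subset where every map is injective or has large fibres *)

Section Refinement.

Context {T T' I : finType} (t : nat) (f : I -> T -> T').
Implicit Types (A B C : {set T}) (U : {set I}).

Definition fibre (g : T -> T') A x := [set z in A | g z == g x].

(** [C] takes one point from each fibre of [g] on [B], which loses at most a factor [t]. *)
Lemma injective_transversal (g : T -> T') B :
  (forall x, x \in B -> #|fibre g B x| <= t) ->
  exists C, [/\ C \subset B, {in C &, injective g} & #|B| <= #|C| * t].
Proof.
move=> small; have partP := preim_partitionP g B; have trP := transversalP partP.
have pbE x y : x \in B -> y \in B ->
    (y \in pblock (preim_partition g B) x) = (g x == g y).
  apply: pblock_equivalence_partition => u v w _ _ _ /=.
  by split=> // /eqP ->.
exists (transversal (preim_partition g B) B); split.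
- exact: transversal_sub trP.
- move=> x y xC yC gxy; apply: (pblock_inj trP) => //.
  have [xB yB] := (subsetP (transversal_sub trP) x xC,
                   subsetP (transversal_sub trP) y yC).
  have tiP := partition_trivIset partP.
  have covP := cover_partition partP.
  by apply/esym/eqP; rewrite eq_sym eq_pblock ?covP // pbE // gxy.
rewrite (card_transversal trP) (card_partition partP) -sum_nat_const.
apply: leq_sum => _ /imsetP[x xB ->].
apply: leq_trans (small x xB); apply/subset_leq_card/subsetP => y.
by rewrite !inE eq_sym.
Qed.

(* Delete, one at a time, elements lying in a fibre of size less than [t]; the
   elements deleted on account of [i] form [B i]: all of those in a given fibre
   were in it when the first of them was deleted. *)
Lemma peel U A : exists A' (B : I -> {set T}),
  [/\ A' \subset A,
      A \subset A' :|: \bigcup_(i in U) B i,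
      forall i x, i \in U -> x \in A' -> t <= #|fibre (f i) A' x| &
      forall i, B i \subset A /\ forall x, x \in B i -> #|fibre (f i) (B i) x| <= t].
Proof.
have [n] := ubnP #|A|; elim: n A => // n IHn A ltAn.
have [/exists_inP[i iU /exists_inP[x xA small]] | big] :=
  boolP [exists i in U, exists x in A, #|fibre (f i) A x| < t]; last first.
  exists A, (fun=> set0); split=> // [|i x iU xA|i].
  - exact: subsetUl.
  - rewrite leqNgt; apply: contra big => ltt; apply/exists_inP; exists i => //.
    by apply/exists_inP; exists x.
  by rewrite sub0set; split=> // x; rewrite inE.
have [|A' [B [sA'A covA bigA' smallB]]] := IHn (A :\ x).
  by move: ltAn; rewrite (cardsD1 x A) xA.
exists A', (fun j => if j == i then x |: B i else B j); split=> // [||j].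
- exact: subset_trans sA'A (subD1set _ _).
- apply/subsetP=> y yA; have [->|neq_yx] := eqVneq y x.
    by apply/setUP; right; apply/bigcupP; exists i; rewrite ?eqxx ?setU11.
  have /(subsetP covA)/setUP[yA'|/bigcupP[j jU yB]] : y \in A :\ x.
  - by rewrite !inE neq_yx.
  - by rewrite inE yA'.
  apply/setUP; right; apply/bigcupP; exists j => //.
  by case: eqP yB => // <- yB; rewrite inE yB orbT.
have [sBA smallj] := smallB j.
have sBA' : B j \subset A := subset_trans sBA (subD1set _ _).
case: eqP => [eq_ji|_]; last by [].
rewrite -eq_ji in small *; have sxB : x |: B j \subset A by rewrite subUset sub1set xA.
(* The class of [x] in [x |: B j] lies in its class in [A], which has fewer than [t] elements; the
   other classes do not change when [x] is added. *)
split=> // y; have [eq_f _|neq_f] := eqVneq (f j x) (f j y).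
  apply: leq_trans (ltnW small); apply/subset_leq_card/subsetP => z.
  by rewrite !inE eq_f => /andP[zB ->]; rewrite andbT (subsetP sxB) // !inE.
rewrite 2!inE; have [eq_yx|_ /= yB] := eqVneq y x; first by rewrite eq_yx eqxx in neq_f.
apply: leq_trans (smallj y yB); apply/subset_leq_card/subsetP => z.
rewrite !inE => /andP[/orP[/eqP->|->] //].
by rewrite (negPf neq_f).
Qed.

(** Induction on [#|U|]. Injectivity passes to subsets, so a settled index stays settled, at a cost
    of at most [K]. Large fibres need not survive, so [H] is fixed only at the last peeling, which
    costs the factor 2. *)
Lemma refine K U A : 0 < K -> 2 * #|U| * t <= K ->
  exists A' (H : {set I}), [/\ A' \subset A, H \subset U, #|A| <= 2 * K ^ #|U| * #|A'|,
    forall i x, i \in H -> x \in A' -> t <= #|fibre (f i) A' x| &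
    forall i, i \in U :\: H -> {in A' &, injective (f i)}].
Proof.
move=> K_gt0; have [n] := ubnP #|U|; elim: n U A => // n IHn U A ltUn leK.
have [A' [B [sA'A covA bigA' smallB]]] := peel U A.
have leA : #|A| <= #|A'| + \sum_(i in U) #|B i|.
  apply: leq_trans (subset_leq_card covA) (leq_trans (leq_card_setU _ _) _).
  rewrite leq_add2l; elim/big_ind2: _ => [|m X p Y leX leY|//].
    by rewrite cards0.
  exact: leq_trans (leq_card_setU _ _) (leq_add leX leY).
have [/exists_inP[i iU leAB] | noB] :=
  boolP [exists i in U, #|A| <= 2 * #|U| * #|B i|]; last first.
  have leA2 : #|A| <= 2 * #|A'|.
    (* No [B i] reaches the proportion [1 / (2 * #|U|)], so at most half of [A] is deleted. *)
    suff leS : 2 * \sum_(i in U) #|B i| <= #|A|.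
      rewrite -(leq_add2r #|A|) addnn -mul2n.
      apply: leq_trans (leq_add (leqnn _) leS).
      by rewrite -mulnDr leq_mul2l.
    have [U0|U_gt0] := posnP #|U|; first by rewrite (cards0_eq U0) big_set0.
    rewrite -(leq_pmul2l U_gt0) -[leqRHS]sum_nat_const mulnA [#|U| * 2]mulnC.
    rewrite big_distrr leq_sum //= => i iU.
    by rewrite ltnW // ltnNge; apply: contra noB => leB; apply/exists_inP; exists i.
  exists A', U; split=> // [|i]; last by rewrite setDv inE.
  rewrite mulnAC (leq_trans leA2) // leq_pmulr //.
  by rewrite expn_gt0 K_gt0.
have [sBA small] := smallB i.
have [C [sCB injC leB]] := injective_transversal _ _ small.
have cardU : #|U| = #|U :\ i|.+1 by rewrite (cardsD1 i U) iU.
(* The recursion abandons [A'] and continues inside [C], where [f i] is injective. *)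
have [||A1 [H [sA1C sHU leC bigH injH]]] := IHn (U :\ i) C.
- by rewrite -ltnS -cardU.
- by apply: leq_trans leK; rewrite cardU leq_mul // leq_mul.
exists A1, H; split=> //.
- exact: subset_trans sA1C (subset_trans sCB sBA).
- exact: subset_trans sHU (subD1set _ _).
- apply: (leq_trans leAB); apply: leq_trans (leq_mul (leqnn _) leB) _.
  rewrite [#|C| * t]mulnC mulnA; apply: leq_trans (leq_mul leK leC) _.
  by rewrite cardU expnS !mulnA [2 * K]mulnC.
move=> j /setDP[jU jH]; have [->|neq_ji] := eqVneq j i; last first.
  by apply: injH; rewrite !inE jH neq_ji.
by move=> x y xA1 yA1; apply: injC; apply: (subsetP sA1C).
Qed.

End Refinement.

(** The cardinalities make [c] bijective on [F] and on [F']: each colour of [e] has one vertex in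
    each, and it is a colour of the intersection exactly when the two coincide. *)
Lemma sub_imset_setI {V T : finType} (c : V -> T) (F F' : {set V}) (e : {set T}) :
    #|F| = #|T| -> c @: F = [set: T] -> #|F'| = #|T| -> c @: F' = [set: T] ->
  (e \subset c @: (F :&: F')) = (F :&: c @^-1: e == F' :&: c @^-1: e).
Proof.
have inj_c (G : {set V}) : #|G| = #|T| -> c @: G = [set: T] -> {in G &, injective c}.
  by move=> cardG cG; apply/imset_injP; rewrite cG cardsT cardG.
move=> cardF cF cardF' cF'; apply/subsetP/eqP => [sub | eqFF' j je].
  have half (G G' : {set V}) : #|G| = #|T| -> c @: G = [set: T] ->
      (forall j, j \in e -> j \in c @: (G :&: G')) ->
      G :&: c @^-1: e \subset G' :&: c @^-1: e.
    move=> cardG cG subG; apply/subsetP=> x; rewrite !inE => /andP[xG cx].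
    have /imsetP[y /setIP[yG yG'] cxy] := subG _ cx.
    by rewrite cx andbT (inj_c G cardG cG x y xG yG cxy).
  apply/eqP; rewrite eqEsubset (half F F') //=.
  by apply: half => // j; rewrite setIC; apply: sub.
have /imsetP[x xF jE] : j \in c @: F by rewrite cF inE.
have : x \in F' :&: c @^-1: e by rewrite -eqFF' !inE xF -jE.
by rewrite inE => /andP[xF' _]; apply/imsetP; exists x; rewrite // inE xF.
Qed.

Lemma inject_of_leq_card {T : finType} (t : nat) (A : {set T}) :
  t <= #|A| -> exists g : 'I_t -> T, injective g /\ forall i, g i \in A.
Proof.
move=> le_tA; exists (fun i => enum_val (widen_ord le_tA i)); split=> [i j|i].
  by move/enum_val_inj/(congr1 val) => /= eq_ij; apply: val_inj.
exact: enum_valP.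
Qed.

(** * Choice of constants and assembly *)

Import Order.TTheory GRing.Theory Num.Theory.
Local Open Scope ring_scope.

Theorem theorem3p9 (s r t : nat) (s_gt0 : (0 < s)%N) (r_gt0 : (0 < r)%N)
    (t_gt0 : (0 < t)%N) (V : finType) (E : {set {set V}})
    (E_uniform : uniform r E) :
  exists (Es : {set {set V}}) (c : V -> 'I_r),
    [/\ Es \subset E,
        (t * r * 2 ^ (2 * r + 1))%:R ^- (\sum_(0 <= k < s.+1) 'C(r, k) + 1)
          * #|E|%:R <= #|Es|%:R :> rat,
        (forall F : {set V}, F \in Es -> c @: F = [set: 'I_r]) &
        exists H : {set {set 'I_r}},
          (forall e : {set 'I_r}, e \in H -> (#|e| <= s)%N) /\
          (forall e : {set 'I_r}, (#|e| <= s)%N ->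
             (e \in H ->
                forall F : {set V}, F \in Es ->
                  exists Fs : 'I_t -> {set V},
                    injective Fs /\
                    forall i : 'I_t,
                      Fs i \in Es /\ e \subset c @: (F :&: Fs i)) /\
             (e \notin H ->
                forall F F' : {set V}, F \in Es -> F' \in Es -> F != F' ->
                  ~~ (e \subset c @: (F :&: F'))))].
Proof.
have [c leE] := exists_rainbow E r_gt0 E_uniform.
set E0 := [set F in E | _] in leE.
pose U := [set e : {set 'I_r} | (#|e| <= s)%N].
pose f (e : {set 'I_r}) (F : {set V}) := F :&: c @^-1: e.
set K := (t * r * 2 ^ (2 * r + 1))%N.
(* This crude bound suffices for the base [K]; the exponent uses [card_small_sets]. *)
have leUr : (#|U| <= 2 ^ r)%N.
  have -> : (2 ^ r = #|powerset [set: 'I_r]|)%N.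
    by rewrite card_powerset cardsT card_ord.
  by rewrite powersetT subset_leq_card ?subsetT.
have K_gt0 : (0 < K)%N by rewrite !muln_gt0 t_gt0 r_gt0 expn_gt0.
have leUK : (2 * #|U| * t <= K)%N.
  rewrite mulnC /K -mulnA leq_mul2l; apply/orP; right.
  apply: leq_trans (leq_pmull _ r_gt0); rewrite addn1 expnS leq_mul2l /=.
  by rewrite (leq_trans leUr) // leq_exp2l // leq_pmull.
(* The loss [4 ^ r] from colouring and the factor 2 from [refine] are absorbed by one more [K], the
   [+ 1] of the exponent. *)
have leK : (2 * 4 ^ r <= K)%N.
  by rewrite -[4%N]/(2 ^ 2)%N -expnM -expnS -(addn1 (2 * r)) /K leq_pmull // muln_gt0 t_gt0.
have [Es [H [sEsE0 sHU leE0 bigH injH]]] := refine t f K U E0 K_gt0 leUK.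
have EsP F : F \in Es -> #|F| = #|'I_r| /\ c @: F = [set: 'I_r].
  move/(subsetP sEsE0); rewrite inE => /andP[FE /eqP ->].
  by rewrite E_uniform ?card_ord.
have subE (e : {set 'I_r}) F F' : F \in Es -> F' \in Es ->
    (e \subset c @: (F :&: F')) = (f e F == f e F').
  by move=> /EsP[? ?] /EsP[? ?]; apply: sub_imset_setI.
have leEs : (#|E| <= K ^ (\sum_(0 <= k < s.+1) 'C(r, k) + 1) * #|Es|)%N.
  apply: (leq_trans leE); apply: leq_trans (leq_mul (leqnn _) leE0) _.
  rewrite addn1 expnS !mulnA leq_mul2r; apply/orP; right.
  by rewrite [(4 ^ r * 2)%N]mulnC leq_mul // leq_pexp2l // card_small_sets.
exists Es, c; split.
- by apply: subset_trans sEsE0 _; apply/subsetP=> F; rewrite inE => /andP[].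
- by rewrite ler_pdivrMl ?exprn_gt0 ?ltr0n // -natrX -natrM ler_nat.
- by move=> F /EsP[].
exists H; split=> [e /(subsetP sHU)|e es]; first by rewrite inE.
split=> [eH F FEs | eH F F' FEs F'Es].
  (* Any [t] members of the class of [F] serve; [F] itself may be one of them. *)
  have [g [inj_g gP]] := inject_of_leq_card t _ (bigH e F eH FEs).
  exists g; split=> // i; have := gP i; rewrite inE => /andP[giEs /eqP fgi].
  by rewrite giEs subE // fgi.
apply: contra; rewrite subE // => /eqP fFF'; apply/eqP.
by apply: (injH e) => //; rewrite !inE eH.
Qed.
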